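(* Let $\alpha$ be an irrational number in $(0,1)$ and let $\tau=R_\alpha$. Let $A_1=[0,b)$ and $A_2=[b,1)$, with $b\in(0,1)$. Suppose that $b\in\mathbb{Z}\alpha$ in $\mathbb{T}=\mathbb{R}/\mathbb{Z}$, i.e. there is $l\in\mathbb{Z}$ with $b\equiv l\alpha \pmod 1$. Let $\phi_1,\phi_2\in H^\infty(\mathbb{D})$ be nonconstant, such that $$|\phi_1^*|^{m(A_1)}\,|\phi_2^*|^{m(A_2)}=1\quad\text{almost everywhere on the unit circle.}$$ Let $T(\omega)=(M_{\phi_1})^*$ if $\omega\in A_1$ and $T(\omega)=(M_{\phi_2})^*$ if $\omega\in A_2$. Then, for every $\omega\in\mathbb{T}$, the sequence $(T_n(\omega))_{n\ge1}$ is not universal.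
   Context: $\mathbb{T}=\mathbb{R}/\mathbb{Z}$, identified with $[0,1)$, is equipped with the normalized Lebesgue measure $m$. $R_\alpha(x)=x+\alpha$ mod $1$. For $\omega\in\mathbb{T}$ and $n\ge1$, $T_n(\omega):=T(\tau^{n-1}\omega)\cdots T(\tau\omega)T(\omega)$. A sequence $(S_n)_{n\ge1}$ of continuous maps on $X$ is universal if there is $x\in X$ such that $\{S_nx:n\ge1\}$ is dense in $X$. $\mathbb{D}$ is the open unit disk, $H^2(\mathbb{D})$ the Hardy (Hilbert) space, $H^\infty(\mathbb{D})$ the bounded holomorphic functions on $\mathbb{D}$. For $\phi\in H^\infty(\mathbb{D})$, $M_\phi f=\phi f$ on $H^2(\mathbb{D})$, $(M_\phi)^*$ is its Hilbert space adjoint, and $\phi^*(e^{it})=\lim_{r\to1^-}\phi(re^{it})$ (defined for a.e. $e^{it}$). *)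

(* Defs.v *)
From HB Require Import structures.
From mathcomp Require Import all_boot all_order all_algebra.
From mathcomp Require Import complex.
From mathcomp Require Import all_classical all_reals all_analysis.

Set Implicit Arguments.
Unset Strict Implicit.
Unset Printing Implicit Defensive.

Import Order.TTheory GRing.Theory Num.Theory.
Import numFieldNormedType.Exports.

Local Open Scope classical_set_scope.
Local Open Scope ring_scope.
Local Open Scope complex_scope.

(* R[i] repackaged as a numClosedFieldType: it is through this structure that
   the topology of a normed field is inferred, so that [derivable] below means
   complex differentiability. Norms `|z| live in C R; the real-valued modulus
   is [normc]. *)
Definition C (R : realType) : numClosedFieldType := R[i].

Definition normc (R : realType) (z : C R) : R := ComplexField.Normc.normc z.

Definition expi (R : realType) (t : R) : C R := cos t +i* sin t.

Definition disk (R : realType) : set (C R) := [set z | normc z < 1].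
Arguments disk {R}.

(* Functions on the disk are represented by total functions C R -> C R; none of
   the notions below depends on the values taken outside the disk. *)
Definition holomorphic (R : realType) (f : C R -> C R) : Prop :=
  forall z, disk z -> derivable f z 1.

Definition Hinfty (R : realType) : set (C R -> C R) :=
  [set f | holomorphic f /\
           exists M : R, forall z, disk z -> normc (f z) <= M].
Arguments Hinfty {R}.

Definition nonconstant (R : realType) (f : C R -> C R) : Prop :=
  ~ exists c, forall z, disk z -> f z = c.

(* The squared norm sup_{0 <= r < 1} (2 pi)^-1 int_0^{2 pi} |f(r e^{it})|^2 dt.
   For f holomorphic the integrand is continuous in t, and the supremum is +oo
   exactly when f is not in the Hardy space. *)
Definition H2sqnorm (R : realType) (f : C R -> C R) : \bar R :=
  ereal_sup [set ((2 * pi)^-1 *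
      \int[@lebesgue_measure R]_(t in `[0, 2 * pi])
        normc (f (r%:C * expi t)) ^+ 2)%:E | r in `[0, 1[ ].

Definition H2 (R : realType) : set (C R -> C R) :=
  [set f | holomorphic f /\ (H2sqnorm f < +oo)%E].
Arguments H2 {R}.

Definition H2norm (R : realType) (f : C R -> C R) : R :=
  Num.sqrt (fine (H2sqnorm f)).

Definition circle_mean (R : realType) (u : R -> C R) : C R :=
  ((2 * pi)^-1 *
     \int[@lebesgue_measure R]_(t in `[0, 2 * pi]) complex.Re (u t)) +i*
  ((2 * pi)^-1 *
     \int[@lebesgue_measure R]_(t in `[0, 2 * pi]) complex.Im (u t)).

(* <f, g> = lim_{r -> 1-} (2 pi)^-1 int_0^{2 pi} f(re^{it}) conj(g(re^{it})) dt;
   the limit exists for f, g in H2, and <f, f> is the squared norm above. *)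
Definition H2dot (R : realType) (f g : C R -> C R) : C R :=
  lim (circle_mean (fun t => f (r%:C * expi t) * (g (r%:C * expi t))^*)
        @[r --> (1 : R)^'-]).

Definition mult_op (R : realType) (phi f : C R -> C R) : C R -> C R :=
  fun z => phi z * f z.

(* B restricted to H2 is the Hilbert space adjoint of A. *)
Definition H2adjoint (R : realType) (A B : (C R -> C R) -> (C R -> C R)) :
    Prop :=
  (forall g, H2 g -> H2 (B g)) /\
  (forall f g, H2 f -> H2 g -> H2dot (A f) g = H2dot f (B g)).

(* The radial limit phi^*(e^{it}). Where the radial limit does not exist, [lim]
   returns the default value 0. *)
Definition boundary (R : realType) (phi : C R -> C R) (t : R) : C R :=
  lim (phi (r%:C * expi t) @[r --> (1 : R)^'-]).

(* R_alpha on T = [0, 1). *)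
Definition rotation (R : realType) (alpha x : R) : R :=
  x + alpha - (Num.floor (x + alpha))%:~R.

(* T_n(w) = T(tau^{n-1} w) ... T(tau w) T(w), with T_0(w) the identity. *)
Fixpoint cocycle (Omega X : Type) (tau : Omega -> Omega)
    (T : Omega -> X -> X) (n : nat) (w : Omega) : X -> X :=
  if n is k.+1 then T (iter k tau w) \o cocycle tau T k w else id.

(* Universality of (S_n)_{n >= 1} acting on the subset X of V, where density in
   X is relative to the norm N. *)
Definition universal (R : realType) (V : zmodType) (X : set V) (N : V -> R)
    (S : nat -> V -> V) : Prop :=
  exists2 x, X x &
    forall y, X y -> forall e : R, 0 < e ->
      exists2 n, (1 <= n)%N & N (S n x - y) < e.

(* The normalized Lebesgue measure m of a subset of T = [0, 1). *)
Definition mT (R : realType) (A : set R) : R := fine (@lebesgue_measure R A).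

(* Main.v *)
Require Import Defs.
From HB Require Import structures.
From mathcomp Require Import all_boot all_order all_algebra.
From mathcomp Require Import complex.
From mathcomp Require Import all_classical all_reals all_analysis.
From mathcomp Require Import ring lra zify.

Set Implicit Arguments.
Unset Strict Implicit.
Unset Printing Implicit Defensive.

Import Order.TTheory GRing.Theory Num.Theory.
Import numFieldNormedType.Exports.

Local Open Scope classical_set_scope.
Local Open Scope ring_scope.

(** Because [b] is a multiple of [alpha] modulo 1, the centred indicator
    [1_[0,b) - b] is a coboundary over the rotation, so that the number of
    visits of an orbit to [A1] in time [n] is [n b + O(1)]. Hence [T_n(w)] is
    the adjoint of multiplication by a product [psi_n] of [n] factors [phi1],
    [phi2] whose boundary modulus is
    [(|phi1^*|^b |phi2^*|^(1-b))^n (|phi1^*| / |phi2^*|)^O(1)], bounded a.e. by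
    a constant [K] independent of [n]. By the mean value property,
    [conj ((T_n x)(0)) = <1, T_n x> = <psi_n, x>], and this is bounded in [n],
    so the orbit of [x] cannot approach a large constant function. The mean
    value property comes from Goursat's bisection argument for [f (exp z)] on
    rectangles of width [2 pi] in the imaginary direction.

    Fatou's theorem is not needed: where a radial limit does not exist,
    [boundary] takes the junk value 0, which the hypothesis on [phi1^*] and
    [phi2^*] excludes almost everywhere. *)

(** * Repeated bisection, integrals on segments, and the Cauchy-Riemann condition *)

Section Bisection.
Variable R : realType.
Local Notation mu := (@lebesgue_measure R).

(** If [J] were nonzero on the whole rectangle, one quarter would carry at least a quarter of its
    absolute value. Iterating gives nested rectangles shrinking to a point, where the local bound is
    eventually violated. *)
Lemma bisection_eq0 (J : R -> R -> R -> R -> R) (a c w h : R) :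
    0 <= w -> 0 <= h ->
    (forall x y s t : R, 0 <= s -> 0 <= t ->
       a <= x -> x + s <= a + w -> c <= y -> y + t <= c + h ->
       J x y s t = J x y (s / 2) (t / 2) + J (x + s / 2) y (s / 2) (t / 2) +
         (J x (y + t / 2) (s / 2) (t / 2) +
          J (x + s / 2) (y + t / 2) (s / 2) (t / 2))) ->
    (forall x0 y0, a <= x0 <= a + w -> c <= y0 <= c + h ->
       forall e : R, 0 < e -> exists2 d : R, 0 < d &
       forall x y s t : R, 0 <= s -> 0 <= t ->
         a <= x -> x + s <= a + w -> c <= y -> y + t <= c + h ->
         x <= x0 <= x + s -> y <= y0 <= y + t -> s + t < d ->
         `|J x y s t| <= e * (s + t) ^+ 2) ->
  J a c w h = 0.
Proof.
move=> w0 h0 Jadd Jloc; apply/eqP/negPn/negP => J0.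
pose ww n := w / 2 ^+ n; pose hh n := h / 2 ^+ n.
have wwS n : ww n.+1 = ww n / 2 by rewrite /ww exprSr invfM mulrA.
have hhS n : hh n.+1 = hh n / 2 by rewrite /hh exprSr invfM mulrA.
have ww0 n : 0 <= ww n by rewrite /ww divr_ge0// exprn_ge0.
have hh0 n : 0 <= hh n by rewrite /hh divr_ge0// exprn_ge0.
pose JJ n (p : R * R) : R := `|J p.1 p.2 (ww n) (hh n)|.
(* Lower left corner of the first quarter that keeps a quarter of |J|; the last quarter is the
   default. *)
pose step n (p : R * R) : R * R :=
  let q i j := (p.1 + i * ww n.+1, p.2 + j * hh n.+1) in
  if JJ n p / 4 <= JJ n.+1 (q 0 0) then q 0 0 else
  if JJ n p / 4 <= JJ n.+1 (q 1 0) then q 1 0 else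
  if JJ n p / 4 <= JJ n.+1 (q 0 1) then q 0 1 else q 1 1.
pose fix p n : R * R := if n is m.+1 then step m (p m) else (a, c).
have pS n : exists i j : R, [/\ p n.+1 = ((p n).1 + i * ww n.+1,
  (p n).2 + j * hh n.+1), 0 <= i <= 1 & 0 <= j <= 1].
  rewrite /= /step.
  do 3! [case: ifP => _; first by do 2 eexists; split; try reflexivity;
    rewrite ?lexx ?ler01].
  by do 2 eexists; split; try reflexivity; rewrite ?lexx ?ler01.
have bnd n : [/\ a <= (p n).1, (p n).1 + ww n <= a + w,
  c <= (p n).2 & (p n).2 + hh n <= c + h].
  elim: n => [|n [IH1 IH2 IH3 IH4]]; first by rewrite /ww /hh /= expr0 !divr1.
  have [i [j [-> /andP[i0 i1] /andP[j0 j1]]]] := pS n; rewrite /=.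
  have w1 := wwS n; have h1 := hhS n; have wn := ww0 n; have hn := hh0 n.
  have := ler_pM i0 (ww0 n.+1) i1 (lexx _);
    have := ler_pM j0 (hh0 n.+1) j1 (lexx _).
  have := mulr_ge0 i0 (ww0 n.+1); have := mulr_ge0 j0 (hh0 n.+1).
  by split; lra.
(* The default choice is sound: if the three other quarters are too small, additivity and the
   triangle inequality make the fourth large enough. *)
have Jp n : JJ 0%N (a, c) / 4 ^+ n <= JJ n (p n).
  elim: n => [|n IH]; first by rewrite expr0 divr1.
  rewrite exprSr invfM mulrA.
  apply: (@le_trans _ _ (JJ n (p n) / 4)); first by rewrite ler_pM2r// invr_gt0.
  rewrite /= /step; set A : R := JJ n (p n) / 4; rewrite !mul0r !addr0 !mul1r.
  case: ifPn => // /negP/negP; rewrite -ltNge => H1.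
  case: ifPn => // /negP/negP; rewrite -ltNge => H2.
  case: ifPn => // /negP/negP; rewrite -ltNge => H3.
  have [b1 b2 b3 b4] := bnd n.
  have := Jadd _ _ _ _ (ww0 n) (hh0 n) b1 b2 b3 b4; rewrite -wwS -hhS => JE.
  move: H1 H2 H3; rewrite /JJ /=.
  have : A * 4 = `|J (p n).1 (p n).2 (ww n) (hh n)| by rewrite /A divfK.
  rewrite {}JE; move: (J _ _ _ _) (J _ _ _ _) (J _ _ _ _) (J _ _ _ _) =>
    j4 j3 j2 j1 E1 H1 H2 H3.
  have := ler_normD (j1 + j2) (j3 + j4); have := ler_normD j1 j2;
    have := ler_normD j3 j4.
  lra.
have mono1 n m : (n <= m)%N -> (p n).1 <= (p m).1 /\ (p m).1 <= (p n).1 + ww n.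
  move=> /subnK<-; move: (m - n)%N => k0; elim: k0 n => [|k IH] n;
    first by rewrite lexx lerDl.
  rewrite addSnnS; have [H1 H2] := IH n.+1.
  have [i [j [E /andP[i0 i1] _]]] := pS n; rewrite E /= in H1 H2.
  have w1 := wwS n; have wn := ww0 n.
  have := ler_pM i0 (ww0 n.+1) i1 (lexx _); have := mulr_ge0 i0 (ww0 n.+1);
    split; lra.
have mono2 n m : (n <= m)%N -> (p n).2 <= (p m).2 /\ (p m).2 <= (p n).2 + hh n.
  move=> /subnK<-; move: (m - n)%N => k0; elim: k0 n => [|k IH] n;
    first by rewrite lexx lerDl.
  rewrite addSnnS; have [H1 H2] := IH n.+1.
  have [i [j [E _ /andP[i0 i1]]]] := pS n; rewrite E /= in H1 H2.
  have w1 := hhS n; have wn := hh0 n.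
  have := ler_pM i0 (hh0 n.+1) i1 (lexx _); have := mulr_ge0 i0 (hh0 n.+1);
    split; lra.
have limP (q r : nat -> R) : (forall n m, (n <= m)%N ->
  q n <= q m /\ q m <= q n + r n) ->
    exists x, forall n, q n <= x <= q n + r n.
  move=> qr; exists (sup (range q)) => n; apply/andP; split.
    apply: ub_le_sup; last by exists n.
    exists (q 0%N + r 0%N) => _ [m _ <-]; exact: (qr 0%N m _).2.
  apply: ge_sup; first by exists (q 0%N), 0%N.
  move=> _ [m _ <-]; have [nm|/ltnW mn] := leqP n m; first exact: (qr _ _ nm).2.
  have := (qr n n (leqnn _)).2; have := (qr _ _ mn).1; lra.
have [x0 x0P] := limP _ _ mono1; have [y0 y0P] := limP _ _ mono2.
(* The local bound at the limit point [(x0, y0)], with [e] chosen so that [e * (w + h) ^+ 2] is at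
   most half of the initial |J|. *)
have [d d0 H] : exists2 d : R, 0 < d & forall n, ww n + hh n < d ->
  JJ 0%N (a,c) / 4 ^+ n <= JJ 0%N (a,c) / (2 * ((w + h) ^+ 2 + 1)) * (ww n + hh
  n) ^+ 2.
  have e0 : 0 < JJ 0%N (a,c) / (2 * ((w + h) ^+ 2 + 1)).
    rewrite divr_gt0//; last by rewrite mulr_gt0// ltr_wpDl// sqr_ge0.
    by rewrite /JJ /ww /hh expr0 !divr1 normr_gt0.
  have x0b : a <= x0 <= a + w by have := x0P 0%N; rewrite /ww expr0 divr1.
  have y0b : c <= y0 <= c + h by have := y0P 0%N; rewrite /hh expr0 divr1.
  have [d d0 Hd] := Jloc x0 y0 x0b y0b _ e0.
  exists d => // n nd; apply: (le_trans (Jp n)).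
  by have [*] := bnd n; apply: Hd.
have [n nd] : exists n, ww n + hh n < d.
  have [n _ Hn] : \forall n \near \oo, (w + h) * (1/2) ^+ n < d.
    have : (w + h) * (1/2) ^+ n @[n --> \oo] --> (w + h) * 0.
      by apply: cvgMl_tmp; apply: cvg_expr; rewrite ger0_norm//; lra.
    by move/cvgr_lt; apply; rewrite mulr0.
  by exists n; have := Hn n (leqnn _);
    rewrite /ww /hh -mulrDl expr_div_n expr1n div1r.
have {H} := H n nd.
(* Both sides scale like [4 ^- n], so this factor cancels and the choice of [e] gives the
   contradiction. *)
have -> : (ww n + hh n) ^+ 2 = (w + h) ^+ 2 / 4 ^+ n.
  have -> : 4 ^+ n = (2 ^+ n) ^+ 2 :> R by rewrite -exprM mulnC exprM;
    congr (_ ^+ n); ring.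
  by rewrite /ww /hh -mulrDl expr_div_n.
rewrite [leRHS]mulrA ler_pM2r ?invr_gt0 ?exprn_gt0//.
have JJ0 : 0 < JJ 0%N (a, c) by rewrite /JJ /ww /hh expr0 !divr1 normr_gt0.
rewrite -mulrA -[leLHS]mulr1 ler_pM2l//.
have q0 := sqr_ge0 (w + h); rewrite mulrC ler_pdivlMr; last lra.
lra.
Qed.

Lemma Rintegral_split (f : R -> R) (a m b : R) : a <= m -> m <= b ->
    mu.-integrable `[a, b] (EFin \o f) ->
  \int[mu]_(x in `[a, b]) f x =
    \int[mu]_(x in `[a, m]) f x + \int[mu]_(x in `[m, b]) f x.
Proof.
move=> am mb fi; rewrite -(@Rintegral_itv_obnd_cbnd _ m).
  by rewrite -(@Rintegral_itvB _ f (BLeft a) (BRight b) m)//; ring.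
apply: integrableS fi => //; apply: subset_itvr; rewrite bnd_simp//.
Qed.

Lemma integrable_itv_cst (a b k : R) :
  mu.-integrable `[a, b] (EFin \o (fun=> k)).
Proof.
apply: continuous_compact_integrable; first exact: segment_compact.
by apply: continuous_subspaceT => x; exact: cvg_cst.
Qed.

Lemma Rintegral_itv_cst (a b k : R) : a <= b ->
  \int[mu]_(x in `[a, b]) k = k * (b - a).
Proof.
move=> ab; rewrite Rintegral_cst//= lebesgue_measure_itv/= lte_fin.
by case: ltgtP ab => // -> _; rewrite subrr.
Qed.

Lemma Rintegral_near_cst (f : R -> R) (a b k M : R) : a <= b ->
    mu.-integrable `[a, b] (EFin \o f) ->
    (forall x, a <= x <= b -> `|f x - k| <= M) ->
  `|\int[mu]_(x in `[a, b]) f x - k * (b - a)| <= M * (b - a).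
Proof.
move=> ab fi fM; have ci := @integrable_itv_cst a b.
rewrite -[in leRHS]Rintegral_itv_cst// -[in leLHS]Rintegral_itv_cst//.
rewrite -RintegralB//.
have fki : mu.-integrable `[a, b] (EFin \o (fun x => f x - k)).
  exact: (integrableB _ fi (ci k)).
apply: le_trans; first exact: le_normr_Rintegral.
apply: le_Rintegral => //.
  exact: integrable_abse fki.
Qed.

(* [u + iv] has complex derivative [p + iq] at [x + iy]. *)
Definition cauchy_riemann_at (u v : R -> R -> R) (x y : R) :=
  exists p q : R, forall e : R, 0 < e -> exists2 d : R, 0 < d &
    forall x' y', `|x' - x| < d -> `|y' - y| < d ->
      `|u x' y' - (u x y + (p * (x' - x) - q * (y' - y)))|
         <= e * (`|x' - x| + `|y' - y|) /\
      `|v x' y' - (v x y + (q * (x' - x) + p * (y' - y)))|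
         <= e * (`|x' - x| + `|y' - y|).

(** Horizontal sides of a rectangle carry [u] and vertical sides carry [v] in the real part of the
    contour integral, whence continuity of [u] in [x] here and of [v] in [y] below. *)
Lemma cauchy_riemann_continuousx u v x y : cauchy_riemann_at u v x y ->
  {for x, continuous (u^~ y)}.
Proof.
move=> [p [q H]]; apply/cvgrPdist_le => e e0.
have [d d0 Hd] := H _ ltr01.
near=> x'.
have xd : `|x' - x| < d by rewrite distrC; near: x'; exact: cvgr_dist_lt.
have [||+ _] := Hd x' y; rewrite ?subrr ?normr0//.
rewrite mulr0 subr0 addr0 mul1r => K.
have xe : `|x' - x| * (1 + `|p|) <= e.
  rewrite -ler_pdivlMr; last by rewrite ltr_pwDl.
  rewrite distrC; near: x'; apply: cvgr_dist_le => //.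
  by rewrite divr_gt0// ltr_pwDl.
rewrite distrC.
have := ler_normD (u x' y - (u x y + p * (x' - x))) (p * (x' - x)).
have -> : u x' y - (u x y + p * (x' - x)) + p * (x' - x) = u x' y - u x y by
  ring.
rewrite normrM; nra.
Unshelve. all: by end_near.
Qed.
End Bisection.

(** * Goursat's theorem on rectangles *)

Section Goursat.
Variable R : realType.
Local Notation mu := (@lebesgue_measure R).

Lemma cauchy_riemann_continuousy (u v : R -> R -> R) x y :
  cauchy_riemann_at u v x y ->
  {for y, continuous (v x)}.
Proof.
move=> [p [q H]]; apply/cvgrPdist_le => e e0.
have [d d0 Hd] := H _ ltr01.
near=> y'.
have yd : `|y' - y| < d by rewrite distrC; near: y'; exact: cvgr_dist_lt.
have [||_ +] := Hd x y'; rewrite ?subrr ?normr0//.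
rewrite mulr0 !add0r mul1r => K.
have ye : `|y' - y| * (1 + `|p|) <= e.
  rewrite -ler_pdivlMr; last by rewrite ltr_pwDl.
  rewrite distrC; near: y'; apply: cvgr_dist_le => //.
  by rewrite divr_gt0// ltr_pwDl.
rewrite distrC.
have := ler_normD (v x y' - (v x y + p * (y' - y))) (p * (y' - y)).
have -> : v x y' - (v x y + p * (y' - y)) + p * (y' - y) = v x y' - v x y by
  ring.
rewrite normrM; nra.
Unshelve. all: by end_near.
Qed.

Lemma cauchy_riemann_integrablex (u v : R -> R -> R) a b y :
    (forall x, a <= x <= b -> cauchy_riemann_at u v x y) ->
  mu.-integrable `[a, b] (EFin \o u^~ y).
Proof.
move=> uv; apply: continuous_compact_integrable; first exact: segment_compact.
apply: continuous_in_subspaceT => x; rewrite inE/= in_itv/= => xab.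
exact: (cauchy_riemann_continuousx (uv _ xab)).
Qed.

Lemma cauchy_riemann_integrabley (u v : R -> R -> R) x c d :
    (forall y, c <= y <= d -> cauchy_riemann_at u v x y) ->
  mu.-integrable `[c, d] (EFin \o v x).
Proof.
move=> uv; apply: continuous_compact_integrable; first exact: segment_compact.
apply: continuous_in_subspaceT => y; rewrite inE/= in_itv/= => ycd.
exact: (cauchy_riemann_continuousy (uv _ ycd)).
Qed.

(* Goursat: the real part of the integral of [u + iv] along the boundary of a
   rectangle is zero. *)
Lemma goursat (u v : R -> R -> R) (a c w h : R) : 0 <= w -> 0 <= h ->
    (forall x y, a <= x <= a + w -> c <= y <= c + h ->
       cauchy_riemann_at u v x y) ->
  \int[mu]_(x in `[a, a + w]) u x c - \int[mu]_(x in `[a, a + w]) u x (c + h) -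
  (\int[mu]_(y in `[c, c + h]) v (a + w) y - \int[mu]_(y in `[c, c + h]) v a y)
  = 0.
Proof.
move=> w0 h0 uv.
pose J x y s t := \int[mu]_(z in `[x, x + s]) u z y -
  \int[mu]_(z in `[x, x + s]) u z (y + t) -
  (\int[mu]_(z in `[y, y + t]) v (x + s) z - \int[mu]_(z in `[y, y + t]) v x z).
have intu x s y : a <= x -> x + s <= a + w -> c <= y <= c + h ->
    mu.-integrable `[x, x + s] (EFin \o u^~ y).
  move=> ax xs yc; apply: cauchy_riemann_integrablex => z zx; apply: uv => //;
    lra.
have intv x y t : a <= x <= a + w -> c <= y -> y + t <= c + h ->
    mu.-integrable `[y, y + t] (EFin \o v x).
  move=> ax xs yc; apply: cauchy_riemann_integrabley => z zx; apply: uv => //;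
    lra.
rewrite -/(J a c w h); apply: bisection_eq0 => //.
  move=> x y s t s0 t0 ax xs cy yt; rewrite /J.
  have Su z : c <= z <= c + h -> \int[mu]_(z0 in `[x, x + s]) u z0 z =
      \int[mu]_(z0 in `[x, x + s / 2]) u z0 z +
      \int[mu]_(z0 in `[x + s / 2, x + s]) u z0 z.
    move=> zc; rewrite (@Rintegral_split _ _ _ (x + s / 2)); try lra.
    exact: intu.
  have Sv z : a <= z <= a + w -> \int[mu]_(z0 in `[y, y + t]) v z z0 =
      \int[mu]_(z0 in `[y, y + t / 2]) v z z0 +
      \int[mu]_(z0 in `[y + t / 2, y + t]) v z z0.
    move=> zc; rewrite (@Rintegral_split _ _ _ (y + t / 2)); try lra.
    exact: intv.
  have E1 : x + s / 2 + s / 2 = x + s by lra.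
  have E2 : y + t / 2 + t / 2 = y + t by lra.
  rewrite E1 E2 !Su ?Sv; try lra.
move=> x0 y0 x0a y0c e e0; have [p [q H]] := uv _ _ x0a y0c.
(* Each pair of opposite sides uses the approximation twice, which costs [e / 2 * (s + t)] per unit
   length. *)
have [d d0 Hd] := H (e / 4) (divr_gt0 e0 (ltr0n _ 4)).
exists d => // x y s t s0 t0 ax xs cy yt xx0 yy0 std.
have near_bound x' y' : x <= x' <= x + s -> y <= y' <= y + t ->
    [/\ `|x' - x0| < d, `|y' - y0| < d &
      e / 4 * (`|x' - x0| + `|y' - y0|) <= e / 4 * (s + t)].
  move=> xx' yy'.
  have Hx : `|x' - x0| <= s by rewrite ler_norml; lra.
  have Hy : `|y' - y0| <= t by rewrite ler_norml; lra.
  by split; [lra|lra|]; rewrite ler_pM2l; lra.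
(* To first order the difference of [u] between bottom and top is [q * t], and that of [v] between
   right and left is [q * s]; the main terms [q * t * s] and [q * s * t] cancel in [J]. *)
have U : `|\int[mu]_(z in `[x, x + s]) (u z y - u z (y + t)) - q * t * s| <= e
  / 2 * (s + t) * s.
  have {2 4}-> : s = x + s - x by ring.
  apply: Rintegral_near_cst; first lra.
    by apply: (integrableB _ (intu _ _ _ _ _ _) (intu _ _ _ _ _ _)) => //; lra.
  move=> z zx.
  have [|h1 h2 h3] := near_bound z y zx; first lra.
  have [|k1 k2 k3] := near_bound z (y + t) zx; first lra.
  have [l1 _] := Hd _ _ h1 h2; have [m1 _] := Hd _ _ k1 k2.
  have := le_trans l1 h3; have := le_trans m1 k3; rewrite !ler_norml; lra.
have V : `|\int[mu]_(z in `[y, y + t]) (v (x + s) z - v x z) - q * s * t| <= e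
  / 2 * (s + t) * t.
  have {2 4}-> : t = y + t - y by ring.
  apply: Rintegral_near_cst; first lra.
    by apply: (integrableB _ (intv _ _ _ _ _ _) (intv _ _ _ _ _ _)) => //; lra.
  move=> z zx.
  have [||h1 h2 h3] := near_bound x z; try lra.
  have [||k1 k2 k3] := near_bound (x + s) z; try lra.
  have [_ l1] := Hd _ _ h1 h2; have [_ m1] := Hd _ _ k1 k2.
  have := le_trans l1 h3; have := le_trans m1 k3; rewrite !ler_norml; lra.
rewrite /J -RintegralB// -?RintegralB//; try (apply: intu => //; lra);
  try (apply: intv => //; lra).
move: U V; rewrite !ler_norml; nra.
Qed.
End Goursat.

(** * Modulus, convergence and differentiability in [C R] *)

Section Complex.
Local Open Scope complex_scope.
Variable R : realType.
Local Notation mu := (@lebesgue_measure R).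
Implicit Types z w : C R.

Lemma norm_normc z : `|z| = (normc z)%:C.
Proof. by []. Qed.

Lemma normc_ge0 z : 0 <= normc z.
Proof. by rewrite -ler0c -norm_normc. Qed.

Lemma normc_le_add z : normc z <= `|complex.Re z| + `|complex.Im z|.
Proof.
case: z => a b; rewrite /normc /= -(@ler_pXn2r _ 2)// ?nnegrE ?sqrtr_ge0
  ?addr_ge0//.
rewrite sqr_sqrtr ?addr_ge0 ?sqr_ge0// sqrrD !real_normK ?num_real//.
by rewrite lerD2r lerDl mulrn_wge0// mulr_ge0.
Qed.

Lemma Re_le_normc z : `|complex.Re z| <= normc z.
Proof.
case: z => a b; rewrite /normc /= -sqrtr_sqr ler_sqrt ?addr_ge0 ?sqr_ge0//.
by rewrite lerDl sqr_ge0.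
Qed.

Lemma Im_le_normc z : `|complex.Im z| <= normc z.
Proof.
case: z => a b; rewrite /normc /= -sqrtr_sqr ler_sqrt ?addr_ge0 ?sqr_ge0//.
by rewrite lerDr sqr_ge0.
Qed.

Lemma normc_sqrE z : normc z ^+ 2 = complex.Re z ^+ 2 + complex.Im z ^+ 2.
Proof. by case: z => a b; rewrite /normc /= sqr_sqrtr ?addr_ge0 ?sqr_ge0. Qed.

Lemma normc_realC (x : R) : normc (x%:C : C R) = `|x|.
Proof. by rewrite /normc /= expr0n/= addr0 sqrtr_sqr. Qed.

Lemma normc_expi (t : R) : normc (expi t) = 1.
Proof. by rewrite /normc /= cos2Dsin2 sqrtr1. Qed.

Lemma normcM z w : normc (z * w) = normc z * normc w.
Proof. exact: ComplexField.Normc.normcM. Qed.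

Lemma normcD z w : normc (z + w) <= normc z + normc w.
Proof. exact: le_normcD. Qed.

Lemma normc_conj z : normc z^* = normc z.
Proof. by case: z => a b; rewrite /normc /= sqrrN. Qed.

Lemma normc_opp z : normc (- z) = normc z.
Proof. by apply: complexI; rewrite -!norm_normc normrN. Qed.

(** Norms take values in [C R], so epsilon is a complex number there; being positive forces its
    imaginary part to vanish, and real epsilons suffice. *)
Lemma cvgC_dist (T : Type) (F : set_system T) (FF : Filter F)
    (f : T -> C R) (l : C R) :
  f x @[x --> F] --> l <->
  forall e : R, 0 < e -> \forall x \near F, normc (l - f x) < e.
Proof.
split=> [/cvgrPdist_lt H e e0|H].
  have e0' : 0 < (e%:C : C R) by rewrite ltcR.
  by apply: filterS (H _ e0') => x; rewrite norm_normc ltcR.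
apply/cvgrPdist_lt => e; rewrite ltcE => /andP[/eqP Ime Ree].
apply: filterS (H _ Ree) => x xl; rewrite norm_normc ltcE/=; apply/andP;
  split=> //.
exact/eqP.
Qed.

Lemma near_normcP (a : C R) (P : C R -> Prop) :
  (\forall z \near a, P z) ->
  exists2 d : R, 0 < d & forall z, normc (z - a) < d -> P z.
Proof.
move=> /nbhs_ballP[e e0 aeP]; move: e0; rewrite /= ltcE => /andP[/eqP Ime Ree].
exists (complex.Re e) => // z za; apply: aeP;
  rewrite -ball_normE /= norm_normc ltcE/=.
by rewrite Ime eqxx -normc_opp opprB.
Qed.

(** Multiplying the difference quotient by [h] extends the estimate to [h = 0]. The field is kept
    general to cover both [R] and [C R]. *)
Lemma derivable_linear_approx (K : numFieldType) (f : K -> K) (z : K) :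
  derivable f z 1 ->
  forall e, 0 < e -> \forall h \near 0,
    `|f (h + z) - f z - 'D_1 f z * h| <= e * `|h|.
Proof.
move=> /cvg_ex[l fl] e e0.
have -> : 'D_1 f z = l by exact: cvg_lim fl.
have /cvgrPdist_le /(_ _ e0) := fl.
rewrite near_withinE => H; near=> h.
have [->|h0] := eqVneq h 0; first by rewrite add0r subrr mulr0 subrr normr0
  mulr0.
have : `|l - h^-1 *: (f (h *: 1 + z) - f z)| <= e by move: h0; near: h;
  exact: H.
rewrite -(@ler_pM2r _ `|h|) ?normr_gt0// -normrM distrC mulrBl.
congr (`|_| <= _); rewrite /GRing.scale /= mulr1.
by rewrite mulrAC mulVf// mul1r.
Unshelve. all: by end_near.
Qed.

Lemma is_derive_linear_approx (f : R -> R) (x k : R) : is_derive x 1 f k ->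
  forall e : R, 0 < e -> exists2 d : R, 0 < d & forall h, `|h| < d ->
    `|f (h + x) - f x - k * h| <= e * `|h|.
Proof.
move=> fk e e0; have := derivable_linear_approx (@ex_derive _ _ _ _ _ _ _ fk)
  e0.
rewrite derive_val => /nbhs_ballP[d d0 H]; exists d => // h hd.
by apply: H; rewrite -ball_normE/= sub0r normrN.
Qed.

Lemma holomorphic_linear_approx (g : C R -> C R) z : holomorphic g ->
  normc z < 1 ->
  exists c : C R, forall e : R, 0 < e ->
    exists2 d : R, 0 < d & forall w, normc (w - z) < d ->
     normc (g w - g z - c * (w - z)) <= e * normc (w - z).
Proof.
move=> hg z1; exists ('D_1 g z) => e e0.
have e0' : 0 < (e%:C : C R) by rewrite ltcR.
have /near_normcP[d d0 H] := derivable_linear_approx (hg z z1) e0'.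
exists d => // w wz; have := H (w - z); rewrite subr0 subrK => /(_ wz).
by rewrite !norm_normc -rmorphM lecR.
Qed.

End Complex.

(** * The complex exponential and the mean value property *)

Section MeanValue.
Local Open Scope complex_scope.
Variable R : realType.
Local Notation mu := (@lebesgue_measure R).
Implicit Types z w : C R.

(** The exponential of x + iy: vertical segments of length 2 pi go to full circles of radius
    [expR x]. *)
Definition expc (x y : R) : C R := (expR x)%:C * expi y.

Lemma normc_expc x y : normc (expc x y) = expR x.
Proof. by rewrite normcM normc_realC normc_expi mulr1 ger0_norm ?expR_ge0. Qed.

Lemma expcD x y x' y' : expc (x + x') (y + y') = expc x y * expc x' y'.
Proof.
rewrite /expc /expi /= expRD cosD sinD /=; apply/eqP; rewrite eq_complex /=.
by apply/andP; split; apply/eqP; ring.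
Qed.

(** The exponential has complex derivative 1 at 0, as follows from the real derivatives of [expR],
    [cos] and [sin] at 0. *)
Lemma expc_near0 (e : R) : 0 < e ->
  exists2 d : R, 0 < d & forall x y, `|x| < d -> `|y| < d ->
  normc (expc x y - 1 - (x +i* y)) <= e * (`|x| + `|y|).
Proof.
(* The errors below add up to at most [2 * k * |x| + 3 * k * |y|], hence [e / 3]; the bound [k <= 1]
   serves the crude estimates of [expR x - 1] and [sin y]. *)
move=> e0; pose k := Num.min (e / 3) 1.
have k0 : 0 < k by rewrite lt_min ltr01 divr_gt0.
have [ke k1] : k <= e / 3 /\ k <= 1 by rewrite /k !ge_min !lexx orbT.
have [d1 d10 H1] := is_derive_linear_approx (is_derive_expR 0) k0.
have [d2 d20 H2] := is_derive_linear_approx (is_derive_cos 0) k0.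
have [d3 d30 H3] := is_derive_linear_approx (is_derive_sin 0) k0.
exists (Num.min (Num.min d1 (k / 4)) (Num.min d2 d3)).
  by rewrite !lt_min d10 d20 d30 divr_gt0.
move=> x y; rewrite !lt_min => /andP[/andP[x1 xk] _] /andP[/andP[_ yk] /andP[y2
  y3]].
have := H1 x x1; have := H2 y y2; have := H3 y y3.
rewrite !addr0 expR0 cos0 sin0 oppr0 !mul0r !subr0 !mul1r addr0 => S3 S2 S1.
apply: (le_trans (normc_le_add _)) => /=; rewrite !mul0r addr0 !subr0.
have -> : expR x * cos y - 1 - x = (expR x - 1 - x) * cos y + (1 + x) * (cos y
  - 1) by ring.
have -> : expR x * sin y - y = (expR x - 1) * sin y + (sin y - y) by ring.
have KX : k * `|x| <= `|x| by rewrite ler_piMl.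
have KY : k * `|y| <= `|y| by rewrite ler_piMl.
have X1 : `|expR x - 1| <= 2 * `|x|.
  have := ler_normD (expR x - 1 - x) x; rewrite subrK; lra.
have Y1 : `|sin y| <= 2 * `|y|.
  have := ler_normD (sin y - y) y; rewrite subrK; lra.
have C1 : `|cos y| <= 1 by rewrite ler_norml cos_geN1 cos_le1.
have T1 := ler_normD ((expR x - 1 - x) * cos y) ((1 + x) * (cos y - 1)).
have T2 := ler_normD ((expR x - 1) * sin y) (sin y - y).
rewrite !normrM in T1 T2.
have U1 : `|expR x - 1 - x| * `|cos y| <= k * `|x| by rewrite -[leRHS]mulr1
  ler_pM.
have U2 : `|1 + x| * `|cos y - 1| <= 2 * (k * `|y|).
  apply: ler_pM => //; have := ler_normD 1 x; rewrite normr1; lra.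
have U3 : `|expR x - 1| * `|sin y| <= k * `|x|.
  apply: le_trans (_ : 2 * `|x| * (k / 2) <= _); last by nra.
  by apply: ler_pM => //; lra.
have := normr_ge0 x; have := normr_ge0 y; nra.
Qed.

(** Chain rule: with [z = expc x y] and [c] the derivative of [g] at [z], the composite has
    derivative [c * z]. The condition [x < 0] puts [z] in the disk. *)
Lemma cauchy_riemann_expc (g : C R -> C R) x y : holomorphic g -> x < 0 ->
  cauchy_riemann_at (fun x y => complex.Re (g (expc x y)))
                    (fun x y => complex.Im (g (expc x y))) x y.
Proof.
move=> hg x0; set z := expc x y.
have z1 : normc z < 1 by rewrite normc_expc expR_lt1.
have [c gc] := holomorphic_linear_approx hg z1.
exists (complex.Re (c * z)), (complex.Im (c * z)) => e e0.
have z0 := normc_ge0 z; have c0 := normc_ge0 c.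
pose k := e / 3.
have k0 : 0 < k by rewrite divr_gt0.
have [d1 d10 H1] := gc _ k0.
(* The total error is at most [k * (2 * s)] from [g] plus [normc c * (l * s)] from the exponential,
   that is [e * s]; [l <= 1] gives the factor 2. *)
pose l := Num.min 1 (e / (3 * (normc c + 1))).
have l0 : 0 < l by rewrite lt_min ltr01 divr_gt0// mulr_gt0//; lra.
have [l1 le] : l <= 1 /\ normc c * l <= e / 3.
  split; first by rewrite /l ge_min lexx.
  have : l <= e / (3 * (normc c + 1)) by rewrite /l ge_min lexx orbT.
  rewrite ler_pdivlMr; last lra.
  nra.
have [d2 d20 H2] := expc_near0 l0.
exists (Num.min (d1 / 4) d2); first by rewrite lt_min d20 divr_gt0.
move=> x' y'; rewrite !lt_min => /andP[xd1 xd2] /andP[yd1 yd2].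
pose dz : C R := (x' - x) +i* (y' - y); pose s := `|x' - x| + `|y' - y|.
have s0 : 0 <= s by rewrite addr_ge0.
have zE : expc x' y' = z * expc (x' - x) (y' - y).
  by rewrite /z -expcD; congr expc; ring.
have {H2} : normc (expc (x' - x) (y' - y) - 1 - dz) <= l * s by exact: H2.
set w := expc x' y' in zE *; set E := expc (x' - x) (y' - y) in zE *; move=> H2.
have dzs : normc dz <= s by exact: normc_le_add.
have E1 : normc (w - z - z * dz) <= l * s.
  have -> : w - z - z * dz = z * (E - 1 - dz) by rewrite zE; ring.
  by rewrite normcM; have := normc_ge0 (E - 1 - dz); nra.
have E2 : normc (w - z) <= 2 * s.
  have -> : w - z = w - z - z * dz + z * dz by ring.
  apply: (le_trans (normcD _ _)); rewrite normcM; have := normc_ge0 dz; nra.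
have E3 : normc (g w - g z - c * z * dz) <= e * s.
  have -> : g w - g z - c * z * dz = g w - g z - c * (w - z) + c * (w - z - z *
    dz) by ring.
  apply: (le_trans (normcD _ _)); rewrite normcM.
  have wd : normc (w - z) < d1 by rewrite /s in E2; lra.
  have := H1 _ wd; have := normc_ge0 (w - z);
    have := normc_ge0 (w - z - z * dz).
  have : k * normc (w - z) <= k * (2 * s) by rewrite ler_pM2l.
  have : normc c * normc (w - z - z * dz) <= normc c * (l * s) by rewrite
    ler_wpM2l.
  have : normc c * l * s <= e / 3 * s by rewrite ler_wpM2r.
  rewrite /k; nra.
split; apply: le_trans E3.
  apply: le_trans (Re_le_normc _); rewrite le_eqVlt; apply/orP; left;
    apply/eqP; congr (`|_|).
  by move: (g w) (g z) (c * z) => [? ?] [? ?] [? ?] /=; ring.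
apply: le_trans (Im_le_normc _); rewrite le_eqVlt; apply/orP; left; apply/eqP;
  congr (`|_|).
by move: (g w) (g z) (c * z) => [? ?] [? ?] [? ?] /=; ring.
Qed.

Lemma holomorphic_continuous0 (g : C R -> C R) : holomorphic g ->
  forall e : R, 0 < e -> exists2 d : R, 0 < d & forall z, normc z < d ->
    normc (g z - g 0) < e.
Proof.
move=> hg e e0.
have [|c gc] := @holomorphic_linear_approx _ g 0 hg;
  first by rewrite /normc ComplexField.Normc.normc0.
have [d d0 H] := gc _ ltr01; have c0 := normc_ge0 c.
exists (Num.min d (e / (normc c + 2))).
  by rewrite lt_min d0 divr_gt0//; lra.
move=> z; rewrite lt_min => /andP[zd ze].
have := H z; rewrite subr0 => /(_ zd); rewrite mul1r => K.
have -> : g z - g 0 = g z - g 0 - c * z + c * z by ring.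
apply: (le_lt_trans (normcD _ _)); rewrite normcM.
move: ze; rewrite ltr_pdivlMr; last lra.
have := normc_ge0 z; lra.
Qed.

Lemma expc_ln (r t : R) : 0 < r -> expc (ln r) t = r%:C * expi t.
Proof. by move=> r0; rewrite /expc lnK ?posrE. Qed.

(** Goursat for [g (expc x y)] on a rectangle of height 2 pi: the horizontal sides cancel by
    periodicity, so the integral over the circle of radius [expR X] does not depend on [X < 0]. As
    [X] decreases the circle shrinks to 0, where [g] is continuous. *)
Lemma mean_value_Im (g : C R -> C R) (r : R) : holomorphic g -> 0 < r < 1 ->
  \int[mu]_(t in `[0, 2 * pi]) complex.Im (g (r%:C * expi t)) =
  2 * pi * complex.Im (g 0).
Proof.
move=> hg /andP[r0 r1]; have pi0 : 0 < pi :> R by exact: pi_gt0.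
pose v x y := complex.Im (g (expc x y)).
have lnr : ln r < 0 by apply: ln_lt0; rewrite r0.
transitivity (\int[mu]_(t in `[0, 2 * pi]) v (ln r) t).
  by apply: eq_Rintegral => t _; rewrite /v expc_ln.
have vE X : X <= ln r -> \int[mu]_(t in `[0, 2 * pi]) v (ln r) t =
    \int[mu]_(t in `[0, 2 * pi]) v X t.
  move=> Xr.
  have := @goursat _ (fun x y => complex.Re (g (expc x y))) v X 0 (ln r - X) (2
    * pi).
  rewrite (_ : X + (ln r - X) = ln r) ?add0r; last ring.
  have per x : expc x (2 * pi) = expc x 0.
    by rewrite /expc /expi -[2 * pi]add0r mulr_natl cosD2pi sinD2pi.
  under eq_Rintegral do rewrite -per.
  rewrite subrr sub0r => H; apply/eqP; rewrite -subr_eq0 -oppr_eq0;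
    apply/eqP/H; try lra.
  by move=> x y xr _; apply: cauchy_riemann_expc => //; lra.
apply/eqP; rewrite -subr_eq0 -normr_le0; apply/ler_addgt0Pl => e e0;
  rewrite addr0.
have [d d0 H] := holomorphic_continuous0 hg (divr_gt0 e0 (mulr_gt0 (ltr0n _ 2)
  pi0)).
(* The circle of radius [expR X] lies within [d / 2] of 0, and [X] stays to the left of [ln r]. *)
pose X := Num.min (ln r) (ln (d / 2)).
have Xr : X <= ln r by rewrite /X ge_min lexx.
have X0 : X < 0 by lra.
rewrite (vE _ Xr).
have -> : 2 * pi * complex.Im (g 0) = complex.Im (g 0) * (2 * pi - 0) by ring.
apply: le_trans (_ : e / (2 * pi) * (2 * pi - 0) <= _); last first.
  by rewrite subr0 divfK// mulf_neq0//; lra.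
apply: Rintegral_near_cst; first lra.
  apply: (@cauchy_riemann_integrabley _ (fun x y =>
    complex.Re (g (expc x y))) v) => y _.
  exact: cauchy_riemann_expc.
move=> t _; have /H/ltW K : normc (expc X t) < d.
  rewrite normc_expc (@le_lt_trans _ _ (d / 2))//; last lra.
  by rewrite -[leRHS]lnK ?posrE ?divr_gt0// ler_expR /X ge_min lexx orbT.
apply: le_trans K; apply: le_trans (Im_le_normc _).
by rewrite /v; move: (g (expc X t)) (g 0) => [? ?] [].
Qed.

End MeanValue.

(** * Means over circles and the Hardy space *)

Section Hardy.
Local Open Scope complex_scope.
Variable R : realType.
Local Notation mu := (@lebesgue_measure R).
Implicit Types (f g : C R -> C R) (F G : R -> R) (r : R).

Definition mean F : R := (2 * pi)^-1 * \int[mu]_(t in `[0, 2 * pi]) F t.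

Lemma pi2_gt0 : 0 < 2 * pi :> R.
Proof. by rewrite mulr_gt0// pi_gt0. Qed.

Lemma continuous_integrable F (a b : R) : continuous F ->
  mu.-integrable `[a, b] (EFin \o F).
Proof.
move=> cF; apply: continuous_compact_integrable; first exact: segment_compact.
exact: continuous_subspaceT.
Qed.

Lemma mean_cst (c : R) : mean (fun=> c) = c.
Proof.
rewrite /mean Rintegral_itv_cst; last exact/ltW/pi2_gt0.
by rewrite subr0 mulrC mulfK// gt_eqF// pi2_gt0.
Qed.

Lemma le_mean F G : continuous F -> continuous G -> (forall t, F t <= G t) ->
  mean F <= mean G.
Proof.
move=> cF cG FG; rewrite /mean ler_pM2l ?invr_gt0 ?pi2_gt0//.
by apply: le_Rintegral => //; exact: continuous_integrable.
Qed.

Lemma meanD F G : continuous F -> continuous G ->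
  mean (fun t => F t + G t) = mean F + mean G.
Proof.
move=> cF cG; rewrite /mean -mulrDr RintegralD//; exact: continuous_integrable.
Qed.

Lemma meanZ c F : continuous F -> mean (fun t => c * F t) = c * mean F.
Proof.
move=> cF; rewrite /mean RintegralZl//; [ring|exact: continuous_integrable].
Qed.

Lemma mean_norm F G : continuous F -> continuous G ->
  (forall t, `|F t| <= G t) -> `|mean F| <= mean G.
Proof.
move=> cF cG FG; rewrite ler_norml; apply/andP; split.
  rewrite -mulN1r -meanZ//; apply: le_mean => //.
    by move=> t; apply: cvgMl_tmp; exact: cG.
  by move=> t; have := FG t; rewrite ler_norml; lra.
by apply: le_mean => // t; have := FG t; rewrite ler_norml; lra.
Qed.

Definition sqmean f r := mean (fun t => normc (f (r%:C * expi t)) ^+ 2).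

Lemma circle_meanE (u : R -> C R) :
  circle_mean u =
  mean (fun t => complex.Re (u t)) +i* mean (fun t => complex.Im (u t)).
Proof. by []. Qed.

Lemma H2sqnormE f :
  H2sqnorm f = ereal_sup [set (sqmean f r)%:E | r in `[0, 1[ ].
Proof. by []. Qed.

Lemma holomorphicM f g : holomorphic f -> holomorphic g ->
  holomorphic (fun z => f z * g z).
Proof. by move=> hf hg z z1; apply: derivableM; [exact: hf|exact: hg]. Qed.

Lemma holomorphic_cst (c : C R) : holomorphic (fun=> c).
Proof. by move=> z _; exact: derivable_cst. Qed.

(** For [r > 0] the circle is parametrized by [expc (ln r)]; for [r = 0] the function is
    constant. *)
Lemma continuous_circle_Im f r : holomorphic f -> 0 <= r < 1 ->
  continuous (fun t => complex.Im (f (r%:C * expi t))).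
Proof.
move=> hf /andP[]; rewrite le_eqVlt => /predU1P[<- _|r0 r1] t.
  rewrite (_ : (fun _ => _) = (fun=> complex.Im (f 0))); first exact: cvg_cst.
  by apply/funext => s; rewrite mul0r.
have := cauchy_riemann_continuousy (@cauchy_riemann_expc _ f (ln r) t hf _).
rewrite ln_lt0 ?r0// => /(_ isT) /=.
by under [X in {for _, continuous X} -> _]funext do rewrite expc_ln//.
Qed.

Lemma Im_imul (z : C R) : complex.Im ('i * z) = complex.Re z.
Proof. by case: z => a b /=; ring. Qed.

Lemma continuous_circle_Re f r : holomorphic f -> 0 <= r < 1 ->
  continuous (fun t => complex.Re (f (r%:C * expi t))).
Proof.
move=> hf r01; have := continuous_circle_Im (holomorphicM (@holomorphic_cst 'i)
  hf) r01.
by under [X in continuous X -> _]funext do rewrite Im_imul.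
Qed.

Lemma continuous_circle_sqr f r : holomorphic f -> 0 <= r < 1 ->
  continuous (fun t => normc (f (r%:C * expi t)) ^+ 2).
Proof.
move=> hf r01; under [X in continuous X]funext do rewrite normc_sqrE 2!expr2.
move=> t; have cR := @continuous_circle_Re f r hf r01 t.
have cI := @continuous_circle_Im f r hf r01 t.
by apply: cvgD; apply: cvgM.
Qed.

Lemma sqmean_ge0 f r : 0 <= sqmean f r.
Proof.
rewrite /sqmean /mean mulr_ge0 ?invr_ge0 ?(ltW pi2_gt0)//.
by apply: Rintegral_ge0 => t _; rewrite sqr_ge0.
Qed.

Lemma H2P f : H2 f <-> holomorphic f /\ exists M : R, forall r, 0 <= r < 1 ->
  sqmean f r <= M.
Proof.
split=> -[hf].
  move=> fy; split=> //; exists (fine (H2sqnorm f)) => r r01.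
  have le1 : ((sqmean f r)%:E <= H2sqnorm f)%E.
    by apply: ereal_sup_ubound; exists r => //; rewrite /= in_itv.
  rewrite -lee_fin fineK// fin_numE -ltey fy andbT.
  by rewrite -ltNye (lt_le_trans _ le1)// ltNyr.
move=> [M fM]; split=> //=; rewrite H2sqnormE.
apply: (@le_lt_trans _ _ M%:E); last exact: ltry.
by apply: ge_ereal_sup => _ [r r01 <-]; rewrite lee_fin fM//; move: r01;
  rewrite /= in_itv.
Qed.

Lemma sqmean_le f r : H2 f -> 0 <= r < 1 -> sqmean f r <= H2norm f ^+ 2.
Proof.
move=> [hf fy] r01; have le1 : ((sqmean f r)%:E <= H2sqnorm f)%E.
  by apply: ereal_sup_ubound; exists r => //; rewrite /= in_itv.
have fin : H2sqnorm f \is a fin_num.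
  rewrite fin_numE -ltey fy andbT.
  by rewrite -ltNye (lt_le_trans _ le1)// ltNyr.
have le2 : sqmean f r <= fine (H2sqnorm f) by rewrite -lee_fin fineK.
by rewrite /H2norm sqr_sqrtr// (le_trans _ le2)// sqmean_ge0.
Qed.

(** The radius 0 belongs to the supremum, and its mean is the squared modulus of [f 0]. *)
Lemma normc0_le_H2norm f : H2 f -> normc (f 0) <= H2norm f.
Proof.
move=> Hf; have := @sqmean_le f 0 Hf; rewrite lexx ltr01 => /(_ isT).
rewrite /sqmean; under [X in mean X]funext do rewrite mul0r.
by rewrite mean_cst ler_pXn2r// nnegrE ?normc_ge0 ?sqrtr_ge0.
Qed.

Lemma disk_circle r t : 0 <= r < 1 -> disk (r%:C * expi t).
Proof.
case/andP=> r0 r1.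
by rewrite /disk /mkset normcM normc_realC normc_expi mulr1 ger0_norm.
Qed.

Lemma Hinfty_H2 f : Hinfty f -> H2 f.
Proof.
move=> [hf [M fM]]; apply/H2P; split=> //; exists (M ^+ 2) => r r01.
rewrite -(mean_cst (M ^+ 2)); apply: le_mean => [| |t].
- exact: continuous_circle_sqr.
- by move=> t; exact: cvg_cst.
- have rM : normc (f (r%:C * expi t)) <= M.
    exact/fM/disk_circle.
  by rewrite ler_pXn2r// nnegrE ?normc_ge0// (le_trans (normc_ge0 _) rM).
Qed.

(** From |f - c|^2 <= 2 |f|^2 + 2 |c|^2 on each circle. *)
Lemma H2_subC f (c : C R) : H2 f -> H2 (fun z => f z - c).
Proof.
move=> /H2P[hf [M fM]]; apply/H2P.
have hfc : holomorphic (fun z => f z - c).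
  by move=> z z1; apply: derivableB; [exact: hf|exact: derivable_cst].
split=> //; exists (2 * M + 2 * normc c ^+ 2) => r r01.
apply: (@le_trans _ _ (2 * sqmean f r + 2 * normc c ^+ 2));
  last by have := fM _ r01; lra.
have cf := continuous_circle_sqr hf r01.
have c2f : continuous (fun t => 2 * normc (f (r%:C * expi t)) ^+ 2).
  by move=> t; apply: cvgMl_tmp; exact: cf.
rewrite /sqmean -meanZ// -[X in _ + X]mean_cst -meanD//; last by move=> t;
  exact: cvg_cst.
apply: le_mean => [| |t].
- exact: continuous_circle_sqr hfc r01.
- by move=> t; apply: cvgD; [exact: c2f|exact: cvg_cst].
have := normcD (f (r%:C * expi t)) (- c); rewrite normc_opp.
move: (normc_ge0 (f (r%:C * expi t) - c)) (normc_ge0 (f (r%:C * expi t)))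
  (normc_ge0 c).
move: (normc (f _ - c)) (normc (f _)) (normc c) => A B D A0 B0 D0 ABD.
have : A ^+ 2 <= (B + D) ^+ 2 by rewrite ler_pXn2r// nnegrE addr_ge0.
have := sqr_ge0 (B - D); nra.
Qed.

End Hardy.

(** * The pairing of the Hardy space and its bound by boundary values *)

Section Pairing.
Local Open Scope complex_scope.
Variable R : realType.
Local Notation mu := (@lebesgue_measure R).
Implicit Types (f g : C R -> C R) (F G : R -> R) (r : R).

(** The real part comes from the imaginary part of ['i * f]. *)
Lemma mean_value f r : holomorphic f -> 0 < r < 1 ->
  circle_mean (fun t => f (r%:C * expi t)) = f 0.
Proof.
move=> hf r01.
have meanIm g : holomorphic g -> mean (fun t =>
  complex.Im (g (r%:C * expi t))) = complex.Im (g 0).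
  by move=> hg; rewrite /mean mean_value_Im// mulKf// gt_eqF// pi2_gt0.
have meanRe := meanIm _ (holomorphicM (@holomorphic_cst _ 'i) hf).
rewrite circle_meanE meanIm//.
under [X in mean X]funext do rewrite -Im_imul.
by rewrite meanRe Im_imul; case: (f 0).
Qed.

Lemma circle_mean_conj (u : R -> C R) :
  continuous (fun t => complex.Im (u t)) ->
  circle_mean (fun t => (u t)^*) = (circle_mean u)^*.
Proof.
move=> cu; rewrite !circle_meanE /=.
have -> : (fun t => complex.Re (u t)^*) = (fun t => complex.Re (u t)).
  by apply/funext => t; case: (u t).
congr (_ +i* _); rewrite -mulN1r -meanZ//; congr mean.
by apply/funext => t; case: (u t) => a b /=; rewrite mulN1r.
Qed.

(** By the mean value property the circle means do not vary with [r] in (0, 1), so their limit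
    exists. *)
Lemma H2dot1 g : holomorphic g -> H2dot (fun=> 1) g = (g 0)^*.
Proof.
move=> hg; apply: cvg_lim; first exact: norm_hausdorff.
apply/cvgC_dist => e e0; near=> r.
have r0 : 0 < r by near: r; exact: nbhs_left_gt.
have r1 : r < 1 by near: r; exact: nbhs_left_lt.
under [X in circle_mean X]funext do rewrite mul1r.
rewrite circle_mean_conj; last by apply: continuous_circle_Im; rewrite // ltW.
rewrite mean_value ?r0// subrr.
by rewrite /normc ComplexField.Normc.normc0.
Unshelve. all: by end_near.
Qed.

Lemma Re_mul_conj (z w : C R) : complex.Re (z * w^*) =
  complex.Re z * complex.Re w + complex.Im z * complex.Im w.
Proof. by case: z w => [a b] [c d] /=; ring. Qed.

Lemma Im_mul_conj (z w : C R) : complex.Im (z * w^*) =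
  complex.Im z * complex.Re w - complex.Re z * complex.Im w.
Proof. by case: z w => [a b] [c d] /=; ring. Qed.

(** The modulus of the integrand is at most (|f|^2 + |g|^2) / 2; real and imaginary parts each
    contribute one such half. *)
Lemma normc_circle_mean_mul_conj f g r : holomorphic f -> holomorphic g ->
  0 <= r < 1 ->
  normc (circle_mean (fun t => f (r%:C * expi t) * (g (r%:C * expi t))^*)) <=
  sqmean f r + sqmean g r.
Proof.
move=> hf hg r01.
have cfR := @continuous_circle_Re _ f r hf r01;
  have cfI := @continuous_circle_Im _ f r hf r01.
have cgR := @continuous_circle_Re _ g r hg r01;
  have cgI := @continuous_circle_Im _ g r hg r01.
have cf := @continuous_circle_sqr _ f r hf r01;
  have cg := @continuous_circle_sqr _ g r hg r01.
pose G t := 2^-1 * (normc (f (r%:C * expi t)) ^+ 2 + normc (g (r%:C * expi t))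
  ^+ 2).
have cG : continuous G by move=> t; apply: cvgMl_tmp; apply: cvgD;
  [exact: cf|exact: cg].
have normG t : normc (f (r%:C * expi t) * (g (r%:C * expi t))^*) <= G t.
  rewrite normcM normc_conj /G.
  by have := sqr_ge0 (normc (f (r%:C * expi t)) - normc (g (r%:C * expi t)));
    nra.
have -> : sqmean f r + sqmean g r = mean G + mean G.
  rewrite /G meanZ ?meanD//; first by rewrite /sqmean; lra.
  by move=> t; apply: cvgD; [exact: cf|exact: cg].
rewrite circle_meanE; apply: (le_trans (normc_le_add _)); apply: lerD.
  apply: mean_norm cG _ => [|t]; last exact: le_trans (Re_le_normc _) (normG t).
  under [X in continuous X]funext do rewrite Re_mul_conj.
  by move=> t; apply: cvgD; apply: cvgM;
    [exact: cfR|exact: cgR|exact: cfI|exact: cgI].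
apply: mean_norm cG _ => [|t]; last exact: le_trans (Im_le_normc _) (normG t).
under [X in continuous X]funext do rewrite Im_mul_conj.
by move=> t; apply: cvgB; apply: cvgM;
  [exact: cfI|exact: cgR|exact: cfR|exact: cgI].
Qed.

Lemma onem_harmonic_itv k : 0 <= 1 - (harmonic k : R) < 1.
Proof.
have h0 : 0 < k.+1%:R^-1 :> R by rewrite invr_gt0 ltr0n.
have h1 : k.+1%:R^-1 <= 1 :> R by rewrite invf_le1 ?ltr0n// ler1n.
by apply/andP; split; [rewrite subr_ge0; exact: h1|rewrite gtrBl; exact: h0].
Qed.

(** Radii tending to 1 along a sequence, as dominated convergence requires. *)
Lemma cvg_harmonic_left : (1 - harmonic k : R) @[k --> \oo] --> (1 : R)^'-.
Proof.
have H : (1 - harmonic k : R) @[k --> \oo] --> (1 : R).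
  by rewrite -[X in _ --> X]subr0; apply: cvgB;
    [exact: cvg_cst|exact: cvg_harmonic].
move=> P /H HP; suff : \forall k \near \oo, P (1 - harmonic k) by [].
have {}HP : \forall k \near \oo,
  (1 - harmonic k < 1 :> R -> P (1 - harmonic k)) by exact: HP.
by apply: filterS HP => k; apply; have /andP[] := onem_harmonic_itv k.
Qed.

Lemma normc_dist (z w : C R) : `|normc z - normc w| <= normc (z - w).
Proof.
rewrite ler_norml; apply/andP; split.
  have := normcD w (- (z - w)) ; have := normcD (w - z) z.
  rewrite subrK -opprB normc_opp; lra.
by have := normcD (z - w) w; rewrite subrK; lra.
Qed.

(** From max(x, 0) = (x + |x|) / 2. *)
Lemma cvg_maxr0 (T : Type) (F : set_system T) (FF : Filter F)
    (f : T -> R) (l : R) :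
  f x @[x --> F] --> l -> Num.max (f x) 0 @[x --> F] --> Num.max l 0.
Proof.
move=> fl; under eq_cvg do rewrite maxr_absE addr0 subr0.
rewrite maxr_absE addr0 subr0; apply: cvgM; last exact: cvg_cst.
by apply: cvgD => //; exact: cvg_norm.
Qed.

(** Dominated convergence for the positive part [G k] of |f|^2 - K^2 on the circles: it is bounded
    because [f] is, and tends to the constant 0 almost everywhere. *)
Lemma sqmean_limit f (K : R) : Hinfty f -> 0 <= K ->
    {ae mu, forall t, 0 <= t < 2 * pi ->
      exists2 l, f (r%:C * expi t) @[r --> (1 : R)^'-] --> l & normc l <= K} ->
  forall e : R, 0 < e -> \forall k \near \oo,
    sqmean f (1 - harmonic k) <= K ^+ 2 + e.
Proof.
move=> [hf [M fM]] K0 fK e e0; have pi0 := pi2_gt0 R.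
pose rk k : R := 1 - harmonic k.
have rk01 k : 0 <= rk k < 1 by exact: onem_harmonic_itv.
pose F k t := normc (f ((rk k)%:C * expi t)) ^+ 2.
pose G k t := Num.max (F k t - K ^+ 2) 0.
have cF k : continuous (F k) by exact: continuous_circle_sqr.
have cG k : continuous (G k).
  by move=> t; apply: cvg_maxr0; apply: cvgB; [exact: cF|exact: cvg_cst].
have F0 k t : 0 <= F k t by exact: sqr_ge0.
have FM k t : F k t <= M ^+ 2.
  have rM : normc (f ((rk k)%:C * expi t)) <= M by exact/fM/disk_circle.
  by rewrite /F ler_pXn2r// nnegrE ?normc_ge0// (le_trans (normc_ge0 _) rM).
have iG k : mu.-integrable `[0,
  2 * pi] (EFin \o G k) by exact: continuous_integrable.
(* The hypothesis speaks of the half-open interval, so the limit is taken there; the endpoint is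
   restored afterwards. *)
have sub : [set` `[0, 2 * pi[ ] `<=` [set` `[0, 2 * (pi : R)] ] 
  by move=> t /=; rewrite !in_itv/= => /andP[-> /ltW].
have iGo k : mu.-integrable `[0,
  2 * pi[ (EFin \o G k) by apply: integrableS (iG k).
have [||||||_ _] := @dominated_convergence _ _ R mu `[0,
  2 * pi[ _ (fun k t => (G k t)%:E)
  (cst 0%E) (cst (M ^+ 2)%:E).
- by [].
- by move=> k; exact: measurable_int (iGo k).
- exact: measurable_cst.
- move: fK; apply: (@filterS _ _ (ae_filter_ringOfSetsType mu)) => t ft;
  rewrite /= in_itv/= => /ft[l fl lK].
  apply: cvg_EFin; first by near=> k.
  have nl : normc (f ((rk k)%:C * expi t)) @[k --> \oo] --> normc l.
    have /cvgC_dist fl' := cvg_comp _ _ cvg_harmonic_left fl.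
    apply/cvgrPdist_lt => d d0; apply: filterS (fl' _ d0) => k;
      apply: le_lt_trans.
    exact: normc_dist.
  have -> : 0 = Num.max (normc l * normc l - K ^+ 2) 0.
    by apply/esym/max_idPr; rewrite subr_le0 -expr2 ler_pXn2r// nnegrE
      normc_ge0.
  by apply: cvg_maxr0; apply: cvgB; [apply: cvgM|exact: cvg_cst].
- apply: integrableS (integrable_itv_cst 0 (2 * pi) (M ^+ 2)) => //.
- apply: aeW => t k _; rewrite /= lee_fin.
  rewrite ger0_norm ?le_max ?lexx ?orbT// ge_max.
  have := FM k t; have := F0 k t; have := sqr_ge0 K; lra.
rewrite integral0 => /fine_cvg Glim.
have : \forall k \near \oo, \int[mu]_(t in `[0, 2 * pi[) G k t < 2 * pi * e.
  apply: (cvgr_lt _ Glim); rewrite mulr_gt0//.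
apply: filterS => k; rewrite Rintegral_itv_bndo_bndc// => Gk.
have -> : K ^+ 2 + e = mean (fun=> K ^+ 2) + e by rewrite mean_cst.
rewrite /sqmean -/(F k).
apply: (@le_trans _ _ (mean (fun=> K ^+ 2) + mean (G k))).
  rewrite -meanD//; last by move=> t; exact: cvg_cst.
  apply: le_mean => //.
    by move=> t; apply: cvgD; [exact: cvg_cst|exact: cG].
  by move=> t; rewrite -lerBlDl /G le_max lexx.
by rewrite lerD2l /mean ler_pdivrMl// ltW.
Unshelve. all: by end_near.
Qed.

(** The bound sees [f] only through [K], which makes it uniform over products of arbitrarily many
    factors. Of the summand 2, one unit pays for the limit of the pairing and one for the mean of
    |f|^2. *)
Lemma normc_H2dot_le f g (K : R) : Hinfty f -> H2 g -> 0 <= K ->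
    {ae mu, forall t, 0 <= t < 2 * pi ->
      exists2 l, f (r%:C * expi t) @[r --> (1 : R)^'-] --> l & normc l <= K} ->
  normc (H2dot f g) <= K ^+ 2 + H2norm g ^+ 2 + 2.
Proof.
move=> Hf Hg K0 fK; have [hf _] := Hf; have [hg _] := Hg.
rewrite /H2dot; set Q := (X in lim X).
(* Without convergence the pairing is the default value 0 and the bound is trivial. *)
have [cQ|/dvgP->] := pselect (cvg Q); last first.
  by rewrite /normc ComplexField.Normc.normc0 !addr_ge0 ?sqr_ge0.
have /cvgC_dist/(_ _ ltr01) H1 := cvg_comp _ _ cvg_harmonic_left cQ.
near \oo => k.
have k1 : normc (lim Q - circle_mean (fun t =>
  f ((1 - harmonic k)%:C * expi t) * (g ((1 - harmonic k)%:C * expi t))^*)) < 1.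
  by near: k.
have k2 : sqmean f (1 - harmonic k) <= K ^+ 2 + 1.
  by near: k; exact: sqmean_limit.
have rk01 := onem_harmonic_itv k.
have k3 := sqmean_le Hg rk01.
have k4 := normc_circle_mean_mul_conj hf hg rk01.
move: k1 k4; set c := circle_mean _ => k1 k4.
have := normcD (lim Q - c) c; rewrite subrK; lra.
Unshelve. all: by end_near.
Qed.

End Pairing.

(** * Visits of a rotation orbit to an interval *)

Section Rotation.
Variable R : realType.
Implicit Types (x b alpha w : R).

Definition frac x : R := x - (Num.floor x)%:~R.

Lemma frac_itv x : 0 <= frac x < 1.
Proof.
have /andP[h1 h2] := floor_itv x; rewrite intrD in h2.
rewrite /frac; lra.
Qed.

Lemma frac_eq x y (m : int) : 0 <= y < 1 -> x = y + m%:~R -> frac x = y.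
Proof.
move=> y01 ->; rewrite /frac (_ : Num.floor _ = m) ?addrK//.
by apply: floor_def; rewrite intrD; lra.
Qed.

Lemma fracDz x (m : int) : frac (x + m%:~R) = frac x.
Proof.
apply: (@frac_eq _ _ (Num.floor x + m)); first exact: frac_itv.
by rewrite intrD /frac; ring.
Qed.

Lemma fracD_frac x y : frac (frac x + y) = frac (x + y).
Proof.
by rewrite -[RHS](fracDz _ (- Num.floor x)) intrN; congr frac; rewrite /frac;
  ring.
Qed.

Lemma iter_rotation alpha w k : 0 <= w < 1 ->
  iter k (rotation alpha) w = frac (w + k%:R * alpha).
Proof.
move=> w01; elim: k => [|k IH] /=.
  by rewrite mul0r addr0; apply/esym/(@frac_eq _ _ 0) => //; rewrite addr0.
by rewrite IH -[LHS]/(frac (_ + alpha)) fracD_frac; congr frac; rewrite -natr1;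
  ring.
Qed.

(** The coboundary identity: subtracting [b] modulo 1 wraps around exactly when [frac x < b]. *)
Lemma indic_sub_frac x b : 0 < b < 1 ->
  (frac x < b)%R%:R - b = frac (x - b) - frac x.
Proof.
move=> b01; have f01 := frac_itv x.
have [fb|fb] := ltP (frac x) b.
  rewrite (@frac_eq (x - b) (frac x - b + 1) (Num.floor x - 1));
    first by rewrite /=; ring.
    lra.
  by rewrite intrD intrN /frac; ring.
rewrite (@frac_eq (x - b) (frac x - b) (Num.floor x)); first by rewrite /=;
  ring.
  lra.
by rewrite /frac; ring.
Qed.

(** Moving the summation window by one changes the sum by a difference of two values of [G], which
    is less than 1 in absolute value; |l| such moves are made. *)
Lemma shifted_sum_bound (G : int -> R) (n : nat) (l : int) :
    (forall i, 0 <= G i < 1) ->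
  `|\sum_(i < n) (G (i%:Z - l) - G i%:Z)| <= `|l|%:~R.
Proof.
move=> G01.
have shift1 s : \sum_(i < n) G (i%:Z + (s + 1)) - \sum_(i < n) G (i%:Z + s) = G
  (n%:Z + s) - G s.
  elim: n => [|n IH]; first by rewrite !big_ord0 (_ : 0%N%:Z + s = s) ?subrr//;
    lia.
  rewrite !big_ord_recr/= (_ : n.+1%:Z + s = n%:Z + (s + 1)); last lia.
  move: IH; lra.
have shift s (m : nat) : `|\sum_(i < n) G (i%:Z + (s + m%:Z)) - \sum_(i < n) G
  (i%:Z + s)| <= m%:R.
  elim: m => [|m IH]; first by rewrite addr0 subrr normr0.
  have := shift1 (s + m%:Z); rewrite -addrA (_ : m%:Z + 1 = m.+1); last lia.
  have := G01 (n%:Z + (s + m%:Z)); have := G01 (s + m%:Z).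
  move: IH; rewrite -natr1 !ler_norml; lra.
rewrite sumrB; case: l => m.
  have := shift (- m%:Z) m; rewrite addNr.
  under [X in X - _]eq_bigr do rewrite addr0.
  by rewrite distrC.
have := shift 0 m.+1; rewrite add0r.
under [X in _ - X]eq_bigr do rewrite addr0.
by rewrite NegzE opprK.
Qed.

(** Modulo 1, subtracting [b] moves [l] steps back along the orbit, so the coboundary identity turns
    the sum into one of [G (i - l) - G i]. *)
Lemma rotation_discrepancy alpha b w (l k : int) n :
    0 < b < 1 -> b = l%:~R * alpha + k%:~R -> 0 <= w < 1 ->
  `|\sum_(i < n) ((iter i (rotation alpha) w < b)%R%:R - b)| <= `|l|%:~R.
Proof.
move=> b01 bE w01.
pose G (i : int) := frac (w + i%:~R * alpha).
rewrite (eq_bigr (fun i : 'I_n => G (i%:Z - l) - G i%:Z)).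
  by apply: shifted_sum_bound => i; exact: frac_itv.
move=> i _; rewrite iter_rotation// indic_sub_frac//; congr (_ - _).
rewrite /G -[RHS](fracDz _ (- k)); congr frac.
by rewrite {1}bE !intrD !intrN; ring.
Qed.

End Rotation.

(** * Products of two weights with geometric mean 1 *)

Section Weights.
Variable R : realType.
Implicit Types (p q b : R).

(** Both exponents are nonzero, so a zero base would make its power, and the product, 0. *)
Lemma powR_prod_eq1 p q b : 0 <= p -> 0 <= q -> 0 < b < 1 ->
    p `^ b * q `^ (1 - b) = 1 ->
  [/\ 0 < p, 0 < q & b * ln p + (1 - b) * ln q = 0].
Proof.
move=> p0 q0 b01; rewrite /powR.
have [|b0] := eqVneq b 0; first lra.
have [|b1] := eqVneq (1 - b) 0; first lra.
have [_|pn0] := eqVneq p 0; first by rewrite mul0r => /eqP;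
  rewrite eq_sym oner_eq0.
have [_|qn0] := eqVneq q 0; first by rewrite mulr0 => /eqP;
  rewrite eq_sym oner_eq0.
rewrite -expRD => /(congr1 (@ln R)); rewrite expRK ln1 => H.
by split=> //; rewrite lt_neqAle eq_sym ?pn0 ?qn0.
Qed.

(* Writing [p = exp P] and [q = exp Q] with [b P + (1 - b) Q = 0], the product
   is the exponential of [(P - Q) * \sum_i (c i - b)]. *)
Lemma prod_two_weights_le p q b M L (n : nat) (c : nat -> bool) :
    0 <= p <= M -> 0 <= q <= M -> 1 <= M -> 0 < b < 1 ->
    p `^ b * q `^ (1 - b) = 1 ->
    `|\sum_(i < n) ((c i)%:R - b)| <= L ->
  \prod_(i < n) (if c i then p else q) <= expR (ln M * (b^-1 + (1 - b)^-1) * L).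
Proof.
move=> /andP[p0 pM] /andP[q0 qM] M1 b01 pq1 sL.
have [{}p0 {}q0 PQ] := powR_prod_eq1 p0 q0 b01 pq1.
set P := ln p in PQ *; set Q := ln q in PQ.
have -> : \prod_(i < n) (if c i then p else q) = expR ((P - Q) * \sum_(i < n)
  ((c i)%:R - b)).
  rewrite mulr_sumr expR_sum; apply: eq_bigr => i _; case: (c i) => /=.
    rewrite -[LHS]lnK ?posrE// -/P; congr expR; move: PQ; lra.
  rewrite -[LHS]lnK ?posrE// -/Q; congr expR; move: PQ; lra.
rewrite ler_expR; apply: (le_trans (ler_norm _)); rewrite normrM ler_pM//.
have PM : P <= ln M by rewrite ler_ln ?posrE//; lra.
have QM : Q <= ln M by rewrite ler_ln ?posrE//; lra.
have M0 : 0 <= ln M by apply: ln_ge0.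
have bi : b * b^-1 = 1 by rewrite divff//; lra.
have ci : (1 - b) * (1 - b)^-1 = 1 by rewrite divff//; lra.
have bi0 : 0 < b^-1 by rewrite invr_gt0; lra.
have ci0 : 0 < (1 - b)^-1 by rewrite invr_gt0; lra.
(* From [b * P + (1 - b) * Q = 0]: this form bounds [P - Q] above through [P <= ln M], and [E2]
   bounds it below through [Q <= ln M]. *)
have E1 : P - Q = P * (1 - b)^-1.
  have : (P - Q) * (1 - b) = P by lra.
  by move=> /(congr1 (fun z => z * (1 - b)^-1)); rewrite -mulrA ci mulr1.
have E2 : Q - P = Q * b^-1.
  have : (Q - P) * b = Q by lra.
  by move=> /(congr1 (fun z => z * b^-1)); rewrite -mulrA bi mulr1.
rewrite ler_norml; nra.
Qed.

Lemma lebesgue_measure_co (a b : R) : a <= b ->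
  mT [set x | a <= x < b] = b - a.
Proof.
move=> ab; rewrite /mT.
have -> : [set x | a <= x < b] = [set` `[a, b[ ] by apply/seteqP; split=> x /=;
  rewrite in_itv.
by rewrite lebesgue_measure_itv/= lte_fin; case: ltgtP ab => // -> _;
  rewrite subrr.
Qed.

End Weights.

(** * The cocycle as an adjoint, and the bound on its values at 0 *)

Section Cocycle.
Variable R : realType.
Local Notation mu := (@lebesgue_measure R).

Lemma Hinfty_cst (c : C R) : Hinfty (fun=> c).
Proof. by split; [exact: holomorphic_cst|exists (normc c)]. Qed.

Lemma HinftyM (f g : C R -> C R) : Hinfty f -> Hinfty g ->
  Hinfty (fun z => f z * g z).
Proof.
move=> [hf [M fM]] [hg [N gN]]; split; first exact: holomorphicM.
exists (M * N) => z z1; rewrite normcM.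
by apply: ler_pM; rewrite ?normc_ge0//; [exact: fM|exact: gN].
Qed.

Lemma Hinfty_prod (phi : nat -> C R -> C R) n : (forall i, Hinfty (phi i)) ->
  Hinfty (fun z => \prod_(i < n) phi i z).
Proof.
move=> Hphi; elim: n => [|n IH].
  by under eq_fun do rewrite big_ord0; exact: Hinfty_cst.
by under eq_fun do rewrite big_ord_recr; exact: HinftyM.
Qed.

(** The operator applied last is the first to move across the pairing, where it multiplies [f] by
    [phi n]. Quantifying over all bounded [f] lets the induction absorb this factor. *)
Lemma H2adjoint_cocycle (Omega : Type) (tau : Omega -> Omega)
    (T : Omega -> (C R -> C R) -> C R -> C R) (w : Omega)
    (phi : nat -> C R -> C R) :
    (forall i, Hinfty (phi i)) ->
    (forall i, H2adjoint (mult_op (phi i)) (T (iter i tau w))) ->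
  forall n g, H2 g -> H2 (cocycle tau T n w g) /\
    forall f : C R -> C R, Hinfty f ->
      H2dot (fun z => (\prod_(i < n) phi i z) * f z) g = H2dot f (cocycle tau T
        n w g).
Proof.
move=> Hphi TA n g Hg; elim: n => [|n [IH1 IH2]] /=.
  split=> [|f Hf]; first exact: Hg.
  by have -> : (fun z => (\prod_(i < 0) phi i z) * f z) = f
    by apply/funext => z; rewrite big_ord0 mul1r.
have [T1 T2] := TA n; split=> [|f Hf]; first exact: T1.
rewrite -(T2 f _ (Hinfty_H2 Hf) IH1) -(IH2 _ (HinftyM (Hphi n) Hf)).
have -> : (fun z => (\prod_(i < n.+1) phi i z) * f z) =
    (fun z => (\prod_(i < n) phi i z) * mult_op (phi n) f z).
  by apply/funext => z; rewrite big_ord_recr; exact: esym (mulrA _ _ _).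
by [].
Qed.

(** A nonzero value cannot be the default of a missing limit. *)
Lemma boundary_cvg (phi : C R -> C R) t : normc (boundary phi t) != 0 ->
  phi (real_complex _ r * expi t) @[r --> (1 : R)^'-] --> boundary phi t.
Proof.
rewrite /boundary => H; set Q := fmap _ _.
have [//|/dvgP E] := pselect (cvg Q).
by move: H; rewrite E /normc ComplexField.Normc.normc0 eqxx.
Qed.

Lemma normc_boundary_le (phi : C R -> C R) t (M : R) : 0 <= M ->
  (forall z, disk z -> normc (phi z) <= M) -> normc (boundary phi t) <= M.
Proof.
move=> M0 phiM; have [->//|/boundary_cvg/cvgC_dist H] := eqVneq (normc
  (boundary phi t)) 0.
apply/ler_addgt0Pl => e e0; near (1 : R)^'- => r.
have r01 : 0 <= r < 1.
  by apply/andP; split; near: r; [exact: nbhs_left_ge|exact: nbhs_left_lt].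
have rd : normc (boundary phi t - phi (real_complex _ r * expi t)) < e.
  by near: r; exact: H.
have rM := phiM _ (disk_circle t r01).
have := normcD (boundary phi t - phi (real_complex _ r * expi t)) (phi
  (real_complex _ r * expi t)).
rewrite subrK; lra.
Unshelve. all: by end_near.
Qed.

Lemma cvg_prodC (T : Type) (F : set_system T) (FF : Filter F)
    (f : nat -> T -> C R) (l : nat -> C R) n :
  (forall i, f i x @[x --> F] --> l i) ->
  \prod_(i < n) f i x @[x --> F] --> \prod_(i < n) l i.
Proof.
move=> fl; elim: n => [|n IH].
  by under eq_cvg do rewrite big_ord0; rewrite big_ord0; exact: cvg_cst.
have -> : (fun x => \prod_(i < n.+1) f i x) = (fun x =>
  (\prod_(i < n) f i x) * f n x).
  by apply/funext => x; rewrite big_ord_recr.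
by rewrite big_ord_recr; exact: cvgM IH (fl n).
Qed.

Lemma normc_prod (l : nat -> C R) n :
  normc (\prod_(i < n) l i) = \prod_(i < n) normc (l i).
Proof.
elim: n => [|n IH]; first by rewrite !big_ord0 /normc ComplexField.Normc.normc1.
by rewrite !big_ord_recr /= normcM IH.
Qed.

(** The value at 0 is, up to conjugation, the pairing of 1 with [T_n x], hence of the product of the
    [phi i] with [x]. The boundary modulus of that product is at most [K] for every [n]. *)
Lemma cocycle_value0_bound (alpha b : R) (phi1 phi2 : C R -> C R)
    (T : R -> (C R -> C R) -> C R -> C R) (w : R) (l k : int) :
    0 < b < 1 -> b = l%:~R * alpha + k%:~R -> 0 <= w < 1 ->
    Hinfty phi1 -> Hinfty phi2 ->
    {ae mu, forall t, 0 <= t < 2 * pi ->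
       normc (boundary phi1 t) `^ b * normc (boundary phi2 t) `^ (1 - b) = 1} ->
    (forall w, 0 <= w < 1 -> H2adjoint (mult_op (if w < b then phi1 else phi2))
      (T w)) ->
  forall x, H2 x -> exists B : R, forall n,
    H2 (cocycle (rotation alpha) T n w x) /\
    normc (cocycle (rotation alpha) T n w x 0) <= B.
Proof.
move=> b01 bE w01 Hphi1 Hphi2 phi12 TA x Hx.
have [h1 [M1 phi1M]] := Hphi1; have [h2 [M2 phi2M]] := Hphi2.
pose M := Num.max 1 (Num.max M1 M2).
have M1' : 1 <= M by rewrite le_max lexx.
(* The bound on products of two weights, with |l| as the discrepancy of the orbit. *)
pose K := expR (ln M * (b^-1 + (1 - b)^-1) * `|l|%:~R).
pose c i := iter i (rotation alpha) w < b.
pose phi i := if c i then phi1 else phi2.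
have Hphi i : Hinfty (phi i) by rewrite /phi; case: (c i).
have Ti i : H2adjoint (mult_op (phi i)) (T (iter i (rotation alpha) w)).
  by apply: TA; rewrite iter_rotation//; exact: frac_itv.
exists (K ^+ 2 + H2norm x ^+ 2 + 2) => n.
have [Hn dotn] := H2adjoint_cocycle Hphi Ti n Hx; split=> //.
have := dotn _ (Hinfty_cst 1); rewrite H2dot1; last by case: Hn.
under [X in H2dot X]eq_fun do rewrite mulr1.
move=> /(congr1 (@normc R)); rewrite normc_conj => <-.
apply: (@normc_H2dot_le _ _ _ K (Hinfty_prod n Hphi) Hx (expR_ge0 _)).
move: phi12; apply: (@filterS _ _ (ae_filter_ringOfSetsType mu)) => t pt t01.
have {}pt := pt t01.
(* Both boundary values are nonzero at such [t], so they are genuine radial limits. *)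
have [p0 q0 _] := powR_prod_eq1 (normc_ge0 _) (normc_ge0 _) b01 pt.
have phit i : phi i (real_complex _ r * expi t) @[r --> (1 :
  R)^'-] --> boundary (phi i) t.
  by apply: boundary_cvg; rewrite /phi; case: (c i); rewrite gt_eqF.
exists (\prod_(i < n) boundary (phi i) t); first exact: cvg_prodC n phit.
rewrite (normc_prod (fun i => boundary (phi i) t)).
under eq_bigr do rewrite /phi (fun_if (fun f => normc (boundary f t))).
apply: (prod_two_weights_le (M := M)) => //.
- rewrite normc_ge0 normc_boundary_le//; first lra.
  by move=> z /phi1M /le_trans; apply; rewrite !le_max lexx orbT.
- rewrite normc_ge0 normc_boundary_le//; first lra.
  by move=> z /phi2M /le_trans; apply; rewrite !le_max lexx !orbT.
- exact: rotation_discrepancy bE w01.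
Qed.

End Cocycle.

(** * No orbit comes close to a large constant function *)

Theorem theorem1p9 (R : realType) (alpha b : R) (A1 A2 : set R)
    (phi1 phi2 : C R -> C R) (T : R -> (C R -> C R) -> (C R -> C R))
    (alpha_itv : 0 < alpha < 1) (alpha_irr : irrational alpha)
    (b_itv : 0 < b < 1)
    (A1E : A1 = [set x | 0 <= x < b]) (A2E : A2 = [set x | b <= x < 1])
    (b_Zalpha : exists l k : int, b = l%:~R * alpha + k%:~R)
    (phi1_Hinfty : Hinfty phi1) (phi2_Hinfty : Hinfty phi2)
    (phi1_nonconst : nonconstant phi1) (phi2_nonconst : nonconstant phi2)
    (phi12 : {ae @lebesgue_measure R, forall t, 0 <= t < 2 * pi ->
       normc (boundary phi1 t) `^ mT A1 * normc (boundary phi2 t) `^ mT A2 = 1})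
    (T_A1 : forall w, A1 w -> H2adjoint (mult_op phi1) (T w))
    (T_A2 : forall w, A2 w -> H2adjoint (mult_op phi2) (T w)) :
  forall w : R, 0 <= w < 1 ->
    ~ universal H2 (@H2norm R) (fun n => cocycle (rotation alpha) T n w).
Proof.
move=> w w01 [x Hx dense]; have [l [k bE]] := b_Zalpha; subst A1 A2.
have /andP[b0 b1] := b_itv.
rewrite !lebesgue_measure_co ?subr0 ?(ltW b0) ?(ltW b1)// in phi12.
have TA u : 0 <= u < 1 -> H2adjoint (mult_op (if u < b then phi1 else phi2)) (T
  u).
  move=> /andP[u0 u1]; case: (ltP u b) => ub; first by apply: T_A1;
    rewrite /= u0.
  by apply: T_A2; rewrite /= ub.
have [B HB] := cocycle_value0_bound b_itv bE w01 phi1_Hinfty phi2_Hinfty phi12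
  TA Hx.
(* The bound includes [n = 0], where the cocycle is the identity. *)
have B0 : 0 <= B by have [_] := HB 0%N; exact: le_trans (normc_ge0 _).
(* An iterate at distance less than 1 from this constant would have modulus greater than [B] at
   0. *)
pose c : C R := real_complex _ (B + 1).
have [n _] := dense (fun=> c) (Hinfty_H2 (Hinfty_cst c)) 1 ltr01.
have [Hn nB] := HB n; set y := cocycle _ _ _ _ _ in Hn nB * => yc.
have H0 : normc (y 0 - c) < 1 := le_lt_trans (normc0_le_H2norm (H2_subC c Hn))
  yc.
have := normcD (c - y 0) (y 0).
rewrite subrK -opprB normc_opp normc_realC ger0_norm; lra.
Qed.
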